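(* A variety $\mathsf{V}$ of Heyting algebras is locally finite if and only if its subvariety $\mathsf{V}'\subseteq\mathsf{V}$ defined (relative to $\mathsf{V}$) by the equation $\neg x\lor\neg\neg x\approx\mathbf{1}$ is locally finite.
   Context: Heyting algebras are algebras $(A;\land,\lor,\to,\neg)$ with $(A;\land,\lor)$ a bounded distributive lattice, $\to$ the relative pseudocomplement and $\neg x=x\to\mathbf{0}$. A variety is locally finite if every finitely generated algebra in it is finite. *)

(* Defs.v *)
From HB Require Import structures.
From mathcomp Require Import all_boot all_order.
From mathcomp Require Import boolp classical_sets functions cardinality.

Set Implicit Arguments.
Unset Strict Implicit.
Unset Printing Implicit Defensive.

Import Order.LTheory.
Local Open Scope classical_set_scope.
Local Open Scope order_scope.

(* The carriers of MathComp's lattices are choiceTypes; by the classical      *)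
(* axioms of boolp every type has such a structure. The one-element algebra   *)
(* (\bot = \top) is allowed.                                                  *)
HB.mixin Record hasHeytingImp d T & Order.TBDistrLattice d T := {
  himp : T -> T -> T;
  le_himp : forall x y z : T, (z <= himp x y) = (z `&` x <= y)
}.

#[short(type="heytingType")]
HB.structure Definition Heyting (d : Order.disp_t) :=
  { T of Order.TBDistrLattice d T & hasHeytingImp d T }.

Definition hneg d (A : heytingType d) (x : A) : A := himp x \bot.

Definition heyting_subalgebra d (A : heytingType d) (S : set A) : Prop :=
  [/\ S \bot /\ S \top,
      forall x y, S x -> S y -> S (x `&` y),
      forall x y, S x -> S y -> S (x `|` y),
      forall x y, S x -> S y -> S (himp x y)
    & forall x, S x -> S (hneg x)].

Definition finitely_generated d (A : heytingType d) : Prop :=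
  exists2 G : set A, finite_set G & smallest (@heyting_subalgebra d A) G = setT.

Inductive hterm : Type :=
| HVar of nat
| HBot
| HTop
| HMeet of hterm & hterm
| HJoin of hterm & hterm
| HImp of hterm & hterm
| HNeg of hterm.

Fixpoint heval d (A : heytingType d) (v : nat -> A) (t : hterm) : A :=
  match t with
  | HVar n => v n
  | HBot => \bot
  | HTop => \top
  | HMeet t1 t2 => heval v t1 `&` heval v t2
  | HJoin t1 t2 => heval v t1 `|` heval v t2
  | HImp t1 t2 => himp (heval v t1) (heval v t2)
  | HNeg t1 => hneg (heval v t1)
  end.

(* The pair (s, t) stands for the equation s ~ t. *)
Definition hequation : Type := (hterm * hterm)%type.

Definition hsatisfies d (A : heytingType d) (e : hequation) : Prop :=
  forall v : nat -> A, heval v e.1 = heval v e.2.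

(* The display d is only a notational tag on the order, so a class ranges     *)
(* over all displays.                                                         *)
Definition heyting_class : Type := forall d, heytingType d -> Prop.

(* A variety is an equational class, with no bound on the set of equations.   *)
Definition is_variety (V : heyting_class) : Prop :=
  exists E : set hequation,
    forall d (A : heytingType d), V d A <-> (forall e, E e -> hsatisfies A e).

Definition relative_subvariety (V : heyting_class) (e : hequation) :
    heyting_class :=
  fun d A => V d A /\ hsatisfies A e.

Definition locally_finite (V : heyting_class) : Prop :=
  forall d (A : heytingType d),
    V d A -> finitely_generated A -> finite_set [set: A].

Definition weak_excluded_middle : hequation :=
  (HJoin (HNeg (HVar 0)) (HNeg (HNeg (HVar 0))), HTop).

Lemma relative_subvariety_is_variety (V : heyting_class) (e : hequation) :
  is_variety V -> is_variety (relative_subvariety V e).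
Proof.
move=> [E VE]; exists (E `|` [set e])%classic => d A; split.
  by move=> [/VE AE Ae] e' [/AE //|->].
by move=> AE; split; [apply/VE => e' Ee'|]; apply: AE; [left|right].
Qed.

(* Main.v *)
(* Let A in V be generated by a finite set G. Call p deciding if p <= ~x or   *)
(* p <= ~~x for every x. For deciding p the quotient of A by the filter of p  *)
(* satisfies weak excluded middle, hence is finite, so there is a least e_p   *)
(* with p <= ~~e_p. The joint refinement of the covers {~g, ~~g}, g in G,     *)
(* is a finite family of deciding elements with dense join; therefore A has   *)
(* finitely many regular elements, and e, the join of the e_p, is the least   *)
(* dense element of A.                                                        *)
(* Let B be the subalgebra generated by the finitely many dense elements      *)
(* x \/ e with x regular or in G. Its elements are 0 or dense, so B satisfies *)
(* weak excluded middle and is finite. The set of x with x \/ e in B contains *)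
(* G and is a subalgebra, so it is A. Since x = ~~x /\ (x \/ e), every        *)
(* element of A is a regular element met with an element of B.                *)
From HB Require Import structures.
Require Import Defs.
From mathcomp Require Import all_boot all_order.
From mathcomp Require Import boolp classical_sets functions cardinality.

Set Implicit Arguments.
Unset Strict Implicit.
Unset Printing Implicit Defensive.

Import Order.LTheory.
Local Open Scope order_scope.

(** Local finiteness of the subvariety enters only through [finite_trace], applied in two places: at
    the deciding elements [p], where it leads to the least dense element [e] ([exists_least_dense]),
    and at [\top], where it makes a subalgebra generated by dense elements finite
    ([finite_generated]). The deciding family with dense join from [exists_deciding_seq] also yields
    [finite_regular], so both factors of [x = ~~x /\ (x \/ e)] range over finite sets. *)

(** * Negation and relativized implication in a Heyting algebra *)

Section HeytingTheory.
Context {d : Order.disp_t} {A : heytingType d}.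
Implicit Types (x y z p : A).

Lemma himpI_le x y : himp x y `&` x <= y.
Proof. by rewrite -le_himp. Qed.

Lemma le_hneg x z : (z <= hneg x) = (z `&` x == \bot).
Proof. by rewrite le_himp lex0. Qed.

Lemma hnegI x : hneg x `&` x = \bot.
Proof. by apply/eqP; rewrite -le_hneg. Qed.

Lemma le_hneg2 x : x <= hneg (hneg x).
Proof. by rewrite le_hneg meetC hnegI. Qed.

Lemma hneg_anti x y : x <= y -> hneg y <= hneg x.
Proof. by move=> xy; rewrite le_hneg -lex0 -(hnegI y) leI2. Qed.

Lemma hneg3 x : hneg (hneg (hneg x)) = hneg x.
Proof. by apply/le_anti; rewrite le_hneg2 andbT hneg_anti// le_hneg2. Qed.

Lemma hnegU x y : hneg (x `|` y) = hneg x `&` hneg y.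
Proof.
apply/le_anti; rewrite lexI !hneg_anti ?leUl ?leUr//=.
by rewrite le_hneg meetUr [_ `&` x]meetAC hnegI meet0x join0x -meetA hnegI
  meetx0.
Qed.

Lemma hneg2_mono x y : x <= y -> hneg (hneg x) <= hneg (hneg y).
Proof. by move=> xy; do 2!apply: hneg_anti. Qed.

Lemma hneg2I x y : hneg (hneg (x `&` y)) = hneg (hneg x) `&` hneg (hneg y).
Proof.
apply/le_anti; rewrite lexI !hneg2_mono ?leIl ?leIr//=.
rewrite le_hneg.
have h : hneg (x `&` y) `&` x `&` y = \bot by rewrite -meetA hnegI.
have h1 : hneg (x `&` y) `&` x <= hneg y by rewrite le_hneg h.
have h2 : hneg (x `&` y) `&` hneg (hneg y) <= hneg x.
  rewrite le_hneg meetAC -lex0 (le_trans (leI2 h1 (lexx _)))//.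
  by rewrite meetC hnegI.
rewrite -meetA [X in _ `&` X]meetC -lex0 (le_trans (leI2 (lexx _) h2))//.
by rewrite hnegI.
Qed.

Lemma hneg0 : hneg \bot = \top :> A.
Proof. by apply/le_anti; rewrite lex1 le_hneg meetx0 eqxx. Qed.

Lemma hneg1 : hneg \top = \bot :> A.
Proof. by rewrite -[LHS]meetx1 hnegI. Qed.

(** Makes meeting with [p] a homomorphism onto the interval below [p], whose implication is [himp]
    cut down by [p]. The case [y = \bot] gives its negation. *)
Lemma himpIr x y p : himp x y `&` p = himp (x `&` p) (y `&` p) `&` p.
Proof.
apply/le_anti; rewrite !lexI !leIr !andbT !le_himp lexI -andbA.
apply/and3P; split.
- by rewrite -meetA (le_trans _ (himpI_le x y))// leI2// leIxr// leIl.
- by rewrite -meetA leIxr// leIl.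
- rewrite -meetA [p `&` x]meetC.
  by rewrite (le_trans (himpI_le _ _)) ?leIl.
Qed.

End HeytingTheory.

(** * Generated subalgebras and their quotients by principal filters *)

Definition hgen d (A : heytingType d) (G : set A) : set A :=
  smallest (@heyting_subalgebra d A) G.

Section Generated.
Context {d : Order.disp_t} {A : heytingType d} (G : set A).
Implicit Types (x y : A).

Lemma hgen_subalgebra : heyting_subalgebra (hgen G).
Proof.
split=> [|x y Gx Gy|x y Gx Gy|x y Gx Gy|x Gx].
- by split=> S [[[]]].
- by move=> S SG; have [[_ h _ _ _] _] := SG; apply: h; [apply: Gx|apply: Gy].
- by move=> S SG; have [[_ _ h _ _] _] := SG; apply: h; [apply: Gx|apply: Gy].
- by move=> S SG; have [[_ _ _ h _] _] := SG; apply: h; [apply: Gx|apply: Gy].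
- by move=> S SG; have [[_ _ _ _ h] _] := SG; apply: h; apply: Gx.
Qed.

Lemma hgen_sub (S : set A) : heyting_subalgebra S -> (G `<=` S)%classic ->
  (hgen G `<=` S)%classic.
Proof. exact: smallest_sub. Qed.

Lemma sub_hgen : (G `<=` hgen G)%classic.
Proof. exact: sub_gen_smallest. Qed.

End Generated.

(* The quotient of the subalgebra hgen G by the filter of p, realized inside  *)
(* the interval [\bot, p]; p itself need not belong to hgen G.                *)
Section Trace.
Context {d : Order.disp_t} {A : heytingType d} (G : set A) (p : A).

Definition in_trace (y : A) : Prop := exists2 x, hgen G x & y = x `&` p.

Definition trace : Type := {y : A | `[< in_trace y >]}.

Definition Trace (y : A) (yP : `[< in_trace y >]) : trace := exist _ y yP.

HB.instance Definition _ := SubChoice.on trace.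
HB.instance Definition _ := [SubChoice_isSubPOrder of trace by <: with d].

Implicit Types (s t u : trace).

Lemma trace_le s : val s <= p.
Proof. by have /asboolP[x _ ->] := valP s; exact: leIr. Qed.

Definition to_trace (x : A) (Gx : hgen G x) : trace :=
  Trace (asboolT (ex_intro2 _ _ x Gx erefl : in_trace (x `&` p))).

Lemma trace_meet_subproof s t : `[< in_trace (val s `&` val t) >].
Proof.
have /asboolP[x Gx ->] := valP s; have /asboolP[y Gy ->] := valP t.
have [_ h _ _ _] := hgen_subalgebra G.
by apply/asboolP; exists (x `&` y); [exact: h|rewrite meetACA meetxx].
Qed.

Lemma trace_join_subproof s t : `[< in_trace (val s `|` val t) >].
Proof.
have /asboolP[x Gx ->] := valP s; have /asboolP[y Gy ->] := valP t.
have [_ _ h _ _] := hgen_subalgebra G.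
by apply/asboolP; exists (x `|` y); [exact: h|rewrite meetUl].
Qed.

Lemma trace_himp_subproof s t : `[< in_trace (himp (val s) (val t) `&` p) >].
Proof.
have /asboolP[x Gx ->] := valP s; have /asboolP[y Gy ->] := valP t.
have [_ _ _ h _] := hgen_subalgebra G.
by apply/asboolP; exists (himp x y); [exact: h|rewrite -himpIr].
Qed.

Lemma trace_bot_subproof : `[< in_trace \bot >].
Proof.
have [[h _] _ _ _ _] := hgen_subalgebra G.
by apply/asboolP; exists \bot; rewrite ?meet0x.
Qed.

Lemma trace_top_subproof : `[< in_trace p >].
Proof.
have [[_ h] _ _ _ _] := hgen_subalgebra G.
by apply/asboolP; exists \top; rewrite ?meet1x.
Qed.

Definition trace_meet s t : trace := Trace (trace_meet_subproof s t).
Definition trace_join s t : trace := Trace (trace_join_subproof s t).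
Definition trace_himp s t : trace := Trace (trace_himp_subproof s t).
Definition trace_bot : trace := Trace trace_bot_subproof.
Definition trace_top : trace := Trace trace_top_subproof.

Fact trace_lexI s t u : (s <= trace_meet t u) = (s <= t) && (s <= u).
Proof. by rewrite !leEsub/= lexI. Qed.

Fact trace_leUx s t u : (trace_join s t <= u) = (s <= u) && (t <= u).
Proof. by rewrite !leEsub/= leUx. Qed.

HB.instance Definition _ :=
  Order.POrder_isMeetSemilattice.Build d trace trace_lexI.
HB.instance Definition _ :=
  Order.POrder_isJoinSemilattice.Build d trace trace_leUx.

Fact trace_meetUl : left_distributive (@Order.meet d trace) Order.join.
Proof. by move=> s t u; apply: val_inj; rewrite /= meetUl. Qed.

HB.instance Definition _ :=
  Order.Lattice_Meet_isDistrLattice.Build d trace trace_meetUl.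

Fact trace_le0x s : trace_bot <= s. Proof. by rewrite leEsub le0x. Qed.
Fact trace_lex1 s : s <= trace_top. Proof. by rewrite leEsub trace_le. Qed.

HB.instance Definition _ := Order.hasBottom.Build d trace trace_le0x.
HB.instance Definition _ := Order.hasTop.Build d trace trace_lex1.

Fact trace_le_himp s t u : (u <= trace_himp s t) = (u `&` s <= t).
Proof. by rewrite !leEsub/= lexI trace_le andbT le_himp. Qed.

HB.instance Definition _ := hasHeytingImp.Build d trace trace_le_himp.

Lemma trace_heval (v : nat -> trace) (w : nat -> A) (t : hterm) :
  (forall n, val (v n) = w n `&` p) ->
  val (heval v t) = heval w t `&` p.
Proof.
move=> vw; elim: t => [n|||t IHt u IHu|t IHt u IHu|t IHt u IHu|t IHt] /=.
- exact: vw.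
- by rewrite meet0x.
- by rewrite meet1x.
- by rewrite IHt IHu meetACA meetxx.
- by rewrite IHt IHu meetUl.
- by rewrite IHt IHu -himpIr.
- by rewrite IHt [RHS]himpIr meet0x.
Qed.

(** Values of terms in [trace] are values in [A] met with [p], so equations of [A] survive. *)
Lemma trace_hsatisfies (e : hequation) : hsatisfies A e -> hsatisfies trace e.
Proof.
move=> Ae v; have vw n : val (v n) = val (v n) `&` p.
  by apply/esym/eqP; rewrite -leEmeet trace_le.
by apply: val_inj; rewrite !(trace_heval _ vw) Ae.
Qed.

Lemma trace_finitely_generated : finite_set G -> finitely_generated trace.
Proof.
(* The default [trace_bot] is never taken on [G]. *)
move=> finG; pose f (g : A) : trace := insubd trace_bot (g `&` p).
have fE g : G g -> val (f g) = g `&` p.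
  move=> Gg; rewrite /f val_insubd ifT//.
  by apply/asboolP; exists g => //; apply: sub_hgen.
exists (f @` G)%classic; first exact: finite_image.
apply/seteqP; split=> // s _ T [[[Tbot Ttop] Tmeet Tjoin Thimp Thneg] fGT].
(* The preimage of [T] under meeting with [p] is a subalgebra containing [G]. *)
have : (hgen G `<=` [set x | exists2 t, T t & val t = (x `&` p)%O])%classic.
  apply: hgen_sub; last first.
    by move=> g Gg; exists (f g); [apply: fGT; exists g|exact: fE].
  split.
  - split; first by exists \bot; rewrite ?meet0x.
    by exists \top; rewrite ?meet1x.
  - move=> x y [t Tt tx] [u Tu uy]; exists (t `&` u); first exact: Tmeet.
    by rewrite /= tx uy meetACA meetxx.
  - move=> x y [t Tt tx] [u Tu uy]; exists (t `|` u); first exact: Tjoin.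
    by rewrite /= tx uy meetUl.
  - move=> x y [t Tt tx] [u Tu uy]; exists (himp t u); first exact: Thimp.
    by rewrite /= tx uy -himpIr.
  - move=> x [t Tt tx]; exists (hneg t); first exact: Thneg.
    by rewrite /= tx [RHS]himpIr meet0x.
have /asboolP[x Gx sx] := valP s.
by move=> /(_ x Gx)[t Tt]; rewrite -sx => /val_inj <-.
Qed.

(** The top of [trace] is [p], and deciding [x] passes to [x /\ p]: negation is antitone, and
    [~~(x /\ p) = ~~x /\ ~~p] lies above [p] when [~~x] does. *)
Lemma trace_weak_excluded_middle :
  (forall x, hgen G x -> p <= hneg x \/ p <= hneg (hneg x)) ->
  hsatisfies trace weak_excluded_middle.
Proof.
move=> Gp v; have vw n : val (v n) = val (v n) `&` p.
  by apply/esym/eqP; rewrite -leEmeet trace_le.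
apply: val_inj; rewrite !(trace_heval _ vw) /= meet1x.
apply/eqP; rewrite meetC -leEmeet.
have /asboolP[x Gx ->] := valP (v 0%N).
have [px|px] := Gp x Gx.
  by rewrite lexUl// (le_trans px)// hneg_anti// leIl.
by rewrite lexUr// hneg2I lexI px le_hneg2.
Qed.

End Trace.

(** * Deciding elements and finiteness *)

(** Reduces deciding all of a generated subalgebra to deciding its generators. *)
Lemma decided_subalgebra d (A : heytingType d) (p : A) :
  heyting_subalgebra [set x | p <= hneg x \/ p <= hneg (hneg x)]%classic.
Proof.
split=> [|x y|x y|x y|x] /=.
- by split; [left; rewrite hneg0 lex1|right; rewrite hneg1 hneg0 lex1].
- move=> [px|px]; first by left; rewrite (le_trans px)// hneg_anti// leIl.
  move=> [py|py]; first by left; rewrite (le_trans py)// hneg_anti// leIr.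
  by right; rewrite hneg2I lexI px.
- move=> [px|px]; last by right; rewrite (le_trans px)// hneg2_mono// leUl.
  move=> [py|py]; last by right; rewrite (le_trans py)// hneg2_mono// leUr.
  by left; rewrite hnegU lexI px.
- move=> px [py|py]; last first.
    by right; rewrite (le_trans py)// hneg2_mono// le_himp leIl.
  case: px => [px|px].
    right; rewrite (le_trans px)// (le_trans _ (le_hneg2 _))// le_himp.
    by rewrite hnegI le0x.
  (* Here [p <= ~~x] and [p <= ~y]. Then [p /\ (x -> y) <= ~x], since a further meet with [x] gives
     [y /\ ~y]; so [p] is disjoint from [x -> y]. *)
  left; rewrite le_hneg -lex0 -(hnegI (hneg x)) lexI leIxl//=.
  rewrite le_hneg -lex0 -(hnegI y) -meetA.
  by rewrite leI2// himpI_le.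
- by move=> [px|px]; [right; rewrite hneg3|left].
Qed.

Section LocallyFinite.
Variable V : heyting_class.
Hypothesis hV : is_variety V.
Hypothesis lfV : locally_finite (relative_subvariety V weak_excluded_middle).
Context {d : Order.disp_t} {A : heytingType d}.
Hypothesis VA : V A.
Implicit Types (x y z p : A) (G : set A).

Lemma finite_trace G p : finite_set G ->
  (forall g, G g -> p <= hneg g \/ p <= hneg (hneg g)) ->
  finite_set [set (x `&` p)%O | x in hgen G]%classic.
Proof.
move=> finG Gp; have : finite_set [set: trace G p]%classic.
  apply: lfV; last exact: trace_finitely_generated.
  split; last first.
    apply: trace_weak_excluded_middle.
    exact: (hgen_sub (decided_subalgebra p) Gp).
  have [E VE] := hV; apply/VE => e Ee.
  by apply: trace_hsatisfies; move: Ee; apply: (VE d A).1.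
move=> /(finite_image val); apply: sub_finite_set => _ [x Gx <-].
by exists (to_trace p Gx).
Qed.

(** Each new [g] splits every [p] into [p /\ ~g] and [p /\ ~~g]. The second clause expresses that
    the join of [P] is dense. *)
Lemma exists_deciding_seq (s : seq A) : exists P : seq A,
  (forall p g, p \in P -> g \in s -> p <= hneg g \/ p <= hneg (hneg g)) /\
  (forall x, (forall p, p \in P -> x `&` p = \bot) -> x = \bot).
Proof.
elim: s => [|g s [P [Ps P0]]].
  by exists [:: \top]; split=> // x /(_ \top); rewrite meetx1 inE eqxx => ->.
exists ([seq p `&` hneg g | p <- P] ++ [seq p `&` hneg (hneg g) | p <- P]).
split=> [p' g'|x x0].
  rewrite mem_cat inE => /orP[|] /mapP[p pP ->] /predU1P[->|gs].
  - by left; rewrite leIr.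
  - by have [h|h] := Ps _ _ pP gs; [left|right]; rewrite leIxl.
  - by right; rewrite leIr.
  - by have [h|h] := Ps _ _ pP gs; [left|right]; rewrite leIxl.
(* Disjointness from the two pieces puts [x /\ p] below both [~~g] and [~~~g]. *)
apply: P0 => p pP; apply/eqP; rewrite -lex0 -(hnegI (hneg (hneg g))) lexI.
rewrite 2!le_hneg -!meetA.
by rewrite !x0 ?eqxx// mem_cat; apply/orP; [left|right]; exact: map_f.
Qed.

Variables (P : seq A) (G : set A).
Hypothesis finG : finite_set G.
Hypothesis genG : hgen G = setT.
Hypothesis PG : forall p g, p \in P -> G g -> p <= hneg g \/ p <= hneg (hneg g).
Hypothesis P0 : forall x, (forall p, p \in P -> x `&` p = \bot) -> x = \bot.

Lemma deciding p x : p \in P -> p <= hneg x \/ p <= hneg (hneg x).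
Proof.
move=> pP.
by apply: (hgen_sub (decided_subalgebra p) (fun g => PG pP)); rewrite genG.
Qed.

(** A regular [~~x] is the double negation of the join of those [p] in [P] below it, so the Boolean
    masks on [P] index all regular elements. *)
Lemma finite_regular : finite_set (range (fun x => hneg (hneg x))).
Proof.
pose f (m : (size P).-tuple bool) : A :=
  hneg (hneg (\join_(p <- mask m P) p)).
apply: (@sub_finite_set _ _ (range f)); last first.
  by apply: finite_image; apply: finite_finset.
move=> _ [x _ <-].
exists (map_tuple (fun p => p <= hneg (hneg x)) (in_tuple P)) => //.
rewrite /f /= -filter_mask big_filter; set j := \join_(_ <- _ | _) _.
apply/le_anti/andP; split.
  by rewrite -[leRHS]hneg3 hneg2_mono//; apply: joins_le.
(* Each [p] is either a joinand of [j], hence disjoint from [~j], or below [~x], hence disjoint from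
   [~~x]. *)
rewrite le_hneg; apply/eqP/P0 => p pP; apply/eqP; rewrite -lex0.
have [px|px] := deciding (hneg x) pP.
  rewrite -(hnegI j) leI2// ?leIr// /j.
  exact: (joins_sup_seq id).
by rewrite -(hnegI (hneg x)) leI2 ?leIl// -(hneg3 x).
Qed.

Lemma exists_least_dense_below p : p \in P -> exists e : A,
  p <= hneg (hneg e) /\ forall x, p <= hneg (hneg x) -> e <= x.
Proof.
move=> pP; have := finite_trace finG (fun g => PG pP); rewrite genG.
move=> /finite_seqP[s sE].
(* The meet is finite because [s] lists all [x /\ p]; such an [x /\ p] qualifies whenever
   [p <= ~~x]. *)
exists (\meet_(y <- s | p <= hneg (hneg y)) y); split.
  elim/big_ind : _ => //; first by rewrite hneg1 hneg0 lex1.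
  by move=> x y px py; rewrite hneg2I lexI px.
move=> x px; apply: (@le_trans _ _ (x `&` p)); last exact: leIl.
apply: (meets_inf_seq id); last by rewrite hneg2I lexI px le_hneg2.
have : [set` s]%classic (x `&` p) by rewrite -sE; exists x.
by [].
Qed.

Lemma exists_least_dense :
  exists e : A, hneg e = \bot /\ forall x, hneg x = \bot -> e <= x.
Proof.
have /choice[f fP] p : exists e : A, p \in P ->
    p <= hneg (hneg e) /\ forall x, p <= hneg (hneg x) -> e <= x.
  have [pP|] := boolP (p \in P); last by exists \bot.
  by have [e] := exists_least_dense_below pP; exists e.
set j := \join_(p <- P) f p; exists j; split.
  apply: P0 => p pP; have [pf _] := fP _ pP.
  apply/eqP; rewrite -lex0 -(hnegI (hneg (f p))) meetC leI2//.
  by rewrite hneg_anti//; exact: (joins_sup_seq f).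
move=> x x0; rewrite /j big_seq; apply: joins_le => p pP.
by have [_] := fP _ pP; apply; rewrite x0 hneg0 lex1.
Qed.

Lemma finite_generated : finite_set [set: A]%classic.
Proof.
have [e [e0 emin]] := exists_least_dense.
(* Since [x \/ ~x] is dense, it lies above [e], and [~~x /\ (x \/ ~x) <= x]. *)
have eE x : hneg (hneg x) `&` (x `|` e) = x.
  apply/le_anti; rewrite lexI le_hneg2 leUl !andbT meetUr leUx leIr/=.
  apply: (le_trans (leI2 (lexx _) (emin (x `|` hneg x) _))).
    by rewrite hnegU meetC hnegI.
  by rewrite meetUr leUx leIr hnegI le0x.
pose R := range (fun x => hneg (hneg x)).
pose F : set A := [set (x `|` e)%O | x in R `|` G]%classic.
pose B := hgen F.
(* Members of [F] lie above the dense [e], so [\top] decides them, and the trace at [\top] is [B]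
   itself. *)
have finB : finite_set B.
  have : finite_set [set (x `&` \top)%O | x in hgen F]%classic.
    apply: finite_trace.
      apply: finite_image; rewrite finite_setU.
      by split=> //; exact: finite_regular.
    by move=> _ [x _ <-]; right; rewrite hnegU e0 meetx0 hneg0.
  by apply: sub_finite_set => x Bx; exists x; rewrite ?meetx1.
have [[_ Btop] Bmeet Bjoin Bhimp _] := hgen_subalgebra F.
have BR x : B (hneg (hneg x) `|` e).
  by apply: sub_hgen; exists (hneg (hneg x)) => //; left; exists x.
have Be : B e by have := BR \bot; rewrite hneg0 hneg1 join0x.
have BA x : B (x `|` e).
  have : (hgen G `<=` [set x | B (x `|` e)%O])%classic.
    2: by rewrite genG; apply.
  have Bimp y z : B (y `|` e) -> B (z `|` e) -> B (himp y z `|` e).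
    move=> By Bz.
    (* From z = ~~z /\ (z \/ e): y -> z is (y -> ~~z) /\ (y -> z \/ e), where *)
    (* y -> ~~z is the regular element ~(y /\ ~z).                           *)
    have -> : himp y z `|` e =
        (hneg (hneg (hneg (y `&` hneg z))) `|` e) `&` himp (y `|` e) (z `|` e).
      apply/le_anti/andP; split.
        rewrite lexI !leUx leUr hneg3 !le_himp; apply/and3P; split.
        - rewrite lexUl// le_hneg meetA -lex0.
          by rewrite -(hnegI z) [leRHS]meetC leI2// himpI_le.
        - by rewrite meetUr leUx lexUl ?himpI_le// lexUr// leIr.
        - by rewrite lexUr// leIl.
      rewrite meetUl leUx [X in _ && X]lexUr ?leIl// andbT lexUl//.
      rewrite le_himp -[leRHS]eE lexI hneg3; apply/andP; split.
        rewrite le_hneg -lex0 -(hnegI (y `&` hneg z)) -!meetA leI2//.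
        by rewrite leIxr.
      apply: le_trans (himpI_le (y `|` e) (z `|` e)).
      by rewrite leI2 ?leIr// leUl.
    by apply: Bmeet; [exact: BR|exact: Bhimp].
  apply: hgen_sub.
    split=> [|y z By Bz|y z By Bz|y z By Bz|y By] /=.
    - by rewrite join0x join1x.
    - by rewrite joinIl; exact: Bmeet.
    - by rewrite -[e]joinxx joinACA; exact: Bjoin.
    - exact: Bimp.
    - by apply: Bimp => //; rewrite join0x.
  by move=> g Gg; apply: sub_hgen; exists g => //; right.
have : finite_set [set (x `&` y)%O | x in R & y in B]%classic.
  by apply: finite_image2 => //; exact: finite_regular.
apply: sub_finite_set => x _; exists (hneg (hneg x)); first by exists x.
by exists (x `|` e).
Qed.

End LocallyFinite.

Theorem theorem8 (V : heyting_class) (hV : is_variety V) :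
  locally_finite V <->
  locally_finite (relative_subvariety V weak_excluded_middle).
Proof.
split=> [lfV d A [VA _]|lfV d A VA [G finG genG]]; first exact: lfV.
have /finite_seqP[s sG] := finG.
have [P [Ps P0]] := exists_deciding_seq s.
apply: (finite_generated hV lfV VA finG genG _ P0) => p g pP.
by rewrite sG; exact: Ps.
Qed.
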